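(* For each $n\ge1$ let $\phi_n:\{-1,+1\}^n\to\{-1,+1\}$ be a function, and let $\eta_n=\phi_n(\xi_1,\ldots,\xi_n)$. Then $(\eta_n)_{n\ge1}$ and $(\xi_n)_{n\ge1}$ have the same law if and only if for each $n\ge1$ and each $K\in\mathbb{K}(n-1)$ there exists $\beta_{n,K}\in\{0,1\}$ such that $$\phi_n(u_1,\ldots,u_n)=\Big(\prod_{K\in\mathbb{K}(n-1)}u_{[K]}^{\beta_{n,K}}\Big)u_n\qquad\text{for all }(u_1,\ldots,u_n)\in\{-1,+1\}^n.$$ Furthermore, for such functions, $$\phi_n(u_1,\ldots,u_n)=\Big(\frac12(-1)^{|\mathcal{B}(n)|}-\frac12\sum_{H\in\mathcal{P}(\mathcal{B}(n))}(-2)^{|H|}u_{[\langle H\rangle]}\Big)u_n,$$ where $\mathcal{B}(n)=\{K\in\mathbb{K}(n-1):\beta_{n,K}=1\}$ and, for $H=\{K_1,\ldots,K_h\}\in\mathcal{P}(\mathcal{B}(n))$, $\langle H\rangle=\bigcup_{j=1}^hK_j$ (with $\langle\emptyset\rangle=\emptyset$).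
   Context: $\xi_1,\xi_2,\ldots$ are independent and identically distributed random variables with $\mathbb{P}(\xi_1=-1)=\mathbb{P}(\xi_1=+1)=\frac12$. For a set $S$, $\mathcal{P}(S)$ is its power set; $\mathbb{K}(n)=\mathcal{P}(\{1,\ldots,n\})$, with $\mathbb{K}(0)=\{\emptyset\}$. For $u_1,u_2,\ldots\in\{-1,+1\}$, set $u_{[\emptyset]}=-1$ and, for a nonempty finite set $K$ of positive integers, $u_{[K]}=\max_{k\in K}u_k$. *)

(* Defs.v *)
From HB Require Import structures.
From mathcomp Require Import all_boot all_order all_algebra finmap.
From mathcomp Require Import all_classical all_reals all_analysis.

Set Implicit Arguments.
Unset Strict Implicit.
Unset Printing Implicit Defensive.

Import Order.TTheory GRing.Theory Num.Theory.

Local Open Scope classical_set_scope.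
Local Open Scope ring_scope.

(* Indices are shifted by one throughout: a sequence (x_n)_{n >= 1} is a
   function on nat whose value at n is x_{n+1}.  Likewise k : 'I_n stands for
   the element k+1 of {1, ..., n}, so that K(n) is {set 'I_n}. *)

(* {-1, +1}; rat so that both stated formulas live in one field *)
Definition pm1 : Type := seq_sub [:: -1; 1 : rat].

Coercion pm1_val (s : pm1) : rat := ssval s.

HB.instance Definition _ := Finite.on pm1.
HB.instance Definition _ :=
  isPointed.Build pm1 (SeqSub (mem_head (-1) [:: 1 : rat])).
HB.instance Definition _ := @isMeasurable.Build default_measure_display
  pm1 discrete_measurable discrete_measurable0
  discrete_measurableC discrete_measurableU.

Section sequence_space.
Context d (E : measurableType d).

Definition coordinate_sets : set (set (nat -> E)) :=
  \bigcup_n preimage_set_system [set: nat -> E] (fun x => x n) measurable.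

(* E^N with the product sigma-algebra *)
Definition seq_space : Type := g_sigma_algebraType coordinate_sets.

HB.instance Definition _ := Measurable.on seq_space.
End sequence_space.

Section laws.
Context d d' (T : measurableType d) (E : measurableType d') (R : realType).
Variable P : probability T R.

(* Equality of laws on the sigma-algebra only: distribution P X is a function
   on all subsets of E. *)
Definition same_law (X Y : {RV P >-> E}) : Prop :=
  forall A : set E, measurable A -> distribution P X A = distribution P Y A.

Definition mutually_independent (X : nat -> {RV P >-> E}) : Prop :=
  forall (J : {fset nat}) (A : nat -> set E),
    (forall j, measurable (A j)) ->
    P (\bigcap_(j in [set` J]) (X j @^-1` A j)) =
    (\prod_(j <- J) P (X j @^-1` A j))%E.

Definition iid (X : nat -> {RV P >-> E}) : Prop :=
  mutually_independent X /\ forall n, same_law (X n) (X 0%N).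

Definition sample_path (X : nat -> {RV P >-> E}) (t : T) : seq_space E :=
  fun n => X n t.

Lemma measurable_sample_path (X : nat -> {RV P >-> E}) :
  measurable_fun [set: T] (sample_path X).
Proof.
apply: (@measurability _ _ T (seq_space E) _ _ (coordinate_sets (E := E))).
  by [].
move=> _ [_ [n _ [A mA <-]] <-].
rewrite setTI setTI.
exact: (measurable_funPTI (X n)).
Qed.

HB.instance Definition _ (X : nat -> {RV P >-> E}) :=
  isMeasurableFun.Build _ _ _ _ (sample_path X) (measurable_sample_path X).

Definition seq_RV (X : nat -> {RV P >-> E}) : {RV P >-> seq_space E} :=
  sample_path X.

End laws.

Section transform.
Context d (T : measurableType d) (R : realType) (P : probability T R).
Variables (phi : forall n : nat, {ffun 'I_n.+1 -> pm1} -> pm1).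
Variable xi : nat -> {RV P >-> pm1}.

Definition eta_fun (n : nat) (t : T) : pm1 :=
  phi [ffun i : 'I_n.+1 => xi i t].

Lemma measurable_eta_fun n : measurable_fun [set: T] (eta_fun n).
Proof.
move=> _ A mA; rewrite setTI.
have -> : eta_fun n @^-1` A =
    \bigcup_(u in [set u | A (phi u)])
      \bigcap_(i in [set: 'I_n.+1]) (xi i @^-1` [set u i]).
  apply/seteqP; split => [t At|t [u Au tu]].
    by exists [ffun i : 'I_n.+1 => xi i t] => //= i _ /=; rewrite ffunE.
  rewrite /= /eta_fun (_ : [ffun i : 'I_n.+1 => xi i t] = u) //.
  by apply/ffunP => i; rewrite ffunE; exact: (tu i Logic.I).
apply: fin_bigcup_measurable; first exact: finite_finset.
move=> u _; apply: fin_bigcap_measurable => [|i _]; first exact: finite_finset.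
exact: (measurable_funPTI (xi i)).
Qed.

HB.instance Definition _ n :=
  isMeasurableFun.Build _ _ _ _ (eta_fun n) (measurable_eta_fun n).

Definition eta_RV (n : nat) : {RV P >-> pm1} := eta_fun n.

End transform.

Arguments eta_RV {d T R P} phi xi n.

(* u_[K] for K a subset of {1, ..., n}; -1 is neutral for max on {-1, +1}, so
   only the value at the empty set depends on the initial -1. *)
Definition umax (n : nat) (u : {ffun 'I_n.+1 -> pm1}) (K : {set 'I_n}) : rat :=
  \big[Num.max/-1]_(k in K) (u (widen_ord (leqnSn n) k) : rat).

(* Main.v *)
Require Import Defs.
From HB Require Import structures.
From mathcomp Require Import all_boot all_order all_algebra finmap.
From mathcomp Require Import all_classical all_reals all_analysis.

Set Implicit Arguments.
Unset Strict Implicit.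
Unset Printing Implicit Defensive.

Import Order.TTheory GRing.Theory Num.Theory.
(** The equivalence splits into three independent facts.

    Probability becomes combinatorics.  The first [n] signs of [xi] are uniform
    on the cube of dimension [n], and the first [n] signs of the transformed
    sequence are the image of those under a self-map of that finite cube,
    [block_map phi].  The law of a sequence is determined by the laws of its
    initial segments ([same_law_cylinderP]), so the two laws agree iff every
    [block_map phi] preserves the uniform measure of a finite set, that is, iff
    it is a bijection ([same_law_eta_injP]).

    Bijectivity is local.  Since [block_map phi] is triangular (its coordinate
    [i] depends on the coordinates up to [i] only), it is injective in every
    dimension iff each [phi n] separates the two values of its last argument
    once the others are fixed ([block_map_injP]); on signs this says
    [phi n u = g u' * u_n] for a sign [g u'] depending on the first [n] entries.

    Every sign-valued [g] on the cube is a product of maxima.  The maximum of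
    [u] over [K] is [-1] exactly when [K] is included in the set [D] of indices
    where [u] is negative ([umaxE]), so the product with exponents [beta] is [-1]
    to the number of [K] included in [D] with [beta K = 1].  Over the field with
    two elements, passing from [beta] to these parities is the zeta transform of
    the lattice of subsets, which is invertible; this is the algebraic normal
    form of Boolean functions ([subset_parity_surj], [last_injectiveP]).

    For the closed formula, write each maximum as [1 - 2 z_K], where [z_K] is
    the indicator of [K] being included in [D], and expand the product over the
    subsets [H] of [B].  Indicators multiply to the indicator of the union, so
    each term is again affine in a single maximum; the constant terms sum to
    [(1 - 2) ^ #|B|] ([umax_expansion]). *)

Local Open Scope ring_scope.

(** * Parities of subset sums *)

Section subset_parity.
Variable I : finType.

Definition subset_parity (b : {ffun {set I} -> bool}) : {ffun {set I} -> bool} :=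
  [ffun D : {set I} => odd (\sum_(K : {set I} | K \subset D) b K)].

(** The transform is triangular for inclusion with unit diagonal: [b K] is
    recovered from the value at [K] and the [b L] with [L] a proper subset. *)
Lemma subset_parity_inj : injective subset_parity.
Proof.
move=> b b' /ffunP bb'; apply/ffunP => K.
have [m] := ubnP #|K|; elim: m K => // m IH K leKm.
move: (bb' K); rewrite !ffunE (bigD1 K) //= [in RHS](bigD1 K) //= !oddD !oddb.
rewrite [X in _ (+) odd X = _](eq_bigr (fun L => b' L : nat)) => [|L /andP[LK nLK]].
  exact: addIb.
congr nat_of_bool; apply: IH; rewrite -ltnS; apply: leq_trans leKm.
by rewrite ltnS proper_card // finset.properEneq nLK LK.
Qed.

Lemma subset_parity_surj (f : {ffun {set I} -> bool}) :
  exists b, subset_parity b = f.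
Proof.
have [g _ gK] := injF_bij subset_parity_inj.
by exists (g f); rewrite gK.
Qed.

End subset_parity.

(** * Products of maxima of signs *)

Lemma pm1P (s : pm1) : pm1_val s = -1 \/ pm1_val s = 1.
Proof.
by move: (valP s); rewrite !inE => /orP[] /eqP; [left|right].
Qed.

(** The last sign is left out, as it never enters a maximum [umax u K]. *)
Definition negatives n (u : {ffun 'I_n.+1 -> pm1}) : {set 'I_n} :=
  [set k | pm1_val (u (widen_ord (leqnSn n) k)) == -1]%SET.

Lemma umaxE n (u : {ffun 'I_n.+1 -> pm1}) (K : {set 'I_n}) :
  umax u K = (-1) ^+ (K \subset negatives u).
Proof.
rewrite /umax; have [/fintype.subsetP sKu|/subsetPn[k kK]] /= := boolP (K \subset _).
  apply: (big_ind (fun x : rat => x = -1)) => // [x y -> ->|k /sKu].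
    exact: maxxx.
  by rewrite inE => /eqP.
rewrite inE => nk; have {nk} uk : pm1_val (u (widen_ord (leqnSn n) k)) = 1.
  by case: (pm1P (u (widen_ord (leqnSn n) k))) nk => [->|//]; rewrite eqxx.
apply/le_anti/andP; split.
  apply: bigmax_le => // i _.
  by case: (pm1P (u (widen_ord (leqnSn n) i))) => ->.
by rewrite -[leLHS]uk; exact: le_bigmax_cond.
Qed.

Lemma prod_umaxE n (u : {ffun 'I_n.+1 -> pm1}) (beta : {set 'I_n} -> bool) :
  \prod_(K : {set 'I_n}) umax u K ^+ beta K =
  (-1) ^+ subset_parity (finfun beta) (negatives u).
Proof.
rewrite ffunE signr_odd -prodrXr [RHS]big_mkcond /=; apply: eq_bigr => K _.
by rewrite umaxE ffunE; case: ifP => _; rewrite ?expr1 ?expr1n.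
Qed.

(** A product of factors [1 - 2 z_K] expands over the subsets of [B]; the
    indicators [z_K] multiply along unions, so that each term of the expansion
    involves one maximum only. *)
Lemma umax_expansion n (u : {ffun 'I_n.+1 -> pm1}) (B : {set {set 'I_n}}) :
  \prod_(K in B) umax u K =
  2^-1 * (-1) ^+ #|B|
  - 2^-1 * \sum_(H in finset.powerset B) (-2) ^+ #|H| * umax u (finset.cover H).
Proof.
pose z (K : {set 'I_n}) : rat := (K \subset negatives u)%:R.
have umaxz K : umax u K = 1 - 2 * z K.
  by rewrite umaxE /z; case: (_ \subset _).
(* Factors outside [B] are padded with [0 + 1]; this kills the subsets [H] that
     are not included in [B]. *)
have expand (c : {set 'I_n} -> rat) :
    \prod_(K in B) (1 + c K) = \sum_(H in finset.powerset B) \prod_(K in H) c K.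
  transitivity (\prod_K ((if K \in B then c K else 0) + 1)).
    rewrite big_mkcond; apply: eq_bigr => K _.
    by case: ifP => _; rewrite ?add0r // addrC.
  rewrite bigA_distr [RHS]big_mkcond /=; apply: eq_bigr => H _.
  rewrite -big_mkcond powersetE; case: ifPn => [/fintype.subsetP HB|].
    by apply: eq_bigr => K /HB ->.
  by case/subsetPn => K KH KB; rewrite (bigD1 K) //= (negPf KB) mul0r.
have zcover H : z (finset.cover H) = \prod_(K in H) z K.
  rewrite /z; have [/bigcupsP sH|/bigcupsP nsH] := boolP (finset.cover H \subset _).
    by rewrite big1 // => K /sH ->.
  have [K KH nK] : exists2 K, K \in H & ~~ (K \subset negatives u).
    apply/exists_inP; rewrite -negb_forall_in; apply/negP => /forall_inP sH.
    by apply: nsH => K /sH.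
  by rewrite (bigD1 K) //= (negPf nK) mul0r.
have -> : \sum_(H in finset.powerset B) (-2) ^+ #|H| * umax u (finset.cover H) =
    (-1) ^+ #|B| - 2 * \prod_(K in B) umax u K.
  have -> : (-1 : rat) = 1 + -2 by [].
  rewrite -prodr_const expand.
  under [in RHS]eq_bigr do rewrite umaxz.
  rewrite expand mulr_sumr -sumrB; apply: eq_bigr => H _.
  rewrite umaxz zcover prodr_const mulrBr mulr1; congr (_ - _).
  rewrite mulrCA; congr (_ * _).
  under [in RHS]eq_bigr do rewrite -mulNr.
  by rewrite big_split prodr_const.
by rewrite mulrBr mulrA mulVf // mul1r subKr.
Qed.

(** * Functions injective in their last argument *)

Definition last_injective (E : Type) n (f : {ffun 'I_n.+1 -> E} -> E) :=
  forall u v : {ffun 'I_n.+1 -> E},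
    (forall k : 'I_n, u (widen_ord (leqnSn n) k) = v (widen_ord (leqnSn n) k)) ->
    f u = f v -> u ord_max = v ord_max.

(** For fixed first entries, [f] is plus or minus its last argument.  The sign
    is read off by setting the last argument to [1], and it is a product of
    maxima because every subset function is a [subset_parity]. *)
Lemma last_injectiveP n (f : {ffun 'I_n.+1 -> pm1} -> pm1) :
  last_injective f <->
  exists beta : {set 'I_n} -> bool, forall u : {ffun 'I_n.+1 -> pm1},
    (f u : rat) = (\prod_(K : {set 'I_n}) umax u K ^+ beta K) * u ord_max.
Proof.
split=> [finj|[beta fE] u v uv fuv]; last first.
  apply: val_inj; move: (fE u); rewrite fuv fE !prod_umaxE.
  have -> : negatives v = negatives u by apply/setP => k; rewrite !inE uv.
  by move/(@lreg_sign rat)/esym.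
pose plus : pm1 := SeqSub (mem_last (-1) [:: 1 : rat]).
pose minus : pm1 := SeqSub (mem_head (-1) [:: 1 : rat]).
(* The point of the cube whose first [n] entries are negative exactly on [D],
   and whose last entry is [1]. *)
pose u_ (D : {set 'I_n}) : {ffun 'I_n.+1 -> pm1} :=
  [ffun i => if unlift ord_max i is Some k then
               if k \in D then minus else plus
             else plus].
have u_max D : u_ D ord_max = plus by rewrite ffunE unlift_none.
have widenE (k : 'I_n) : widen_ord (leqnSn n) k = lift ord_max k.
  by apply: val_inj; exact: (esym (lift_max k)).
have u_widen (u : {ffun 'I_n.+1 -> pm1}) k :
    u_ (negatives u) (widen_ord (leqnSn n) k) = u (widen_ord (leqnSn n) k).
  rewrite ffunE {1}widenE liftK inE; apply: val_inj.
  by case: (pm1P (u (widen_ord (leqnSn n) k))) => uk; rewrite uk; case: eqP.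
have [beta betaE] := subset_parity_surj
  [ffun D : {set 'I_n} => pm1_val (f (u_ D)) == -1].
exists beta => u; rewrite prod_umaxE ffunK betaE ffunE.
have [u1|u1] := pm1P (u ord_max).
  (* [u] ends in [-1] and agrees with [u_ (negatives u)] before, so [f] takes
     opposite values at the two points. *)
  rewrite u1; have : f u <> f (u_ (negatives u)).
    move=> /esym /finj-/(_ (u_widen u)) /(congr1 pm1_val).
    by rewrite u_max u1.
  case: (pm1P (f u)) => fu; case: (pm1P (f (u_ (negatives u)))) => fu_ neq;
    rewrite fu fu_ //; case: neq; apply: val_inj; exact: etrans fu (esym fu_).
have -> : u_ (negatives u) = u.
  apply/ffunP => i; case: (unliftP ord_max i) => [k ->|->].
    by rewrite -widenE.
  by rewrite u_max; apply: val_inj; exact: esym u1.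
by rewrite u1; case: (pm1P (f u)) => ->.
Qed.

(** * Causal maps and their action on initial segments *)

Section causal_maps.
Variables (E : pointedType) (phi : forall n : nat, {ffun 'I_n.+1 -> E} -> E).

Definition initial n (x : nat -> E) : {ffun 'I_n -> E} := [ffun i : 'I_n => x i].

Definition causal_map (x : nat -> E) (n : nat) : E := phi (initial n.+1 x).

Lemma initialP n x y :
  initial n x = initial n y <-> forall i, (i < n)%N -> x i = y i.
Proof.
split=> [/ffunP xy i ltin|xy]; first by move: (xy (Ordinal ltin)); rewrite !ffunE.
by apply/ffunP => i; rewrite !ffunE xy.
Qed.

(** Finite words are padded to sequences so that initial segments of all lengths
    can be compared without casts between ordinal types. *)
Definition extend n (u : {ffun 'I_n -> E}) (i : nat) : E :=
  oapp u point (insub i).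

Lemma initial_extend n : cancel (@extend n) (initial n).
Proof. by move=> u; apply/ffunP => i; rewrite ffunE /extend valK. Qed.

Definition block_map n (u : {ffun 'I_n -> E}) : {ffun 'I_n -> E} :=
  initial n (causal_map (extend u)).

Lemma initial_causal_map n x :
  initial n (causal_map x) = block_map (initial n x).
Proof.
apply/initialP => i ltin; congr phi; apply/initialP => j leji.
have ltjn : (j < n)%N by exact: leq_trans leji ltin.
have /initialP -> // := initial_extend (initial n x).
Qed.

(** A triangular map is inverted coordinate by coordinate.  Conversely, two
    words of length [n.+1] that agree before their last entry have images that
    agree before the last entry, so injectivity of the block map must come from
    [phi n]. *)
Lemma block_map_injP :
  (forall n, injective (@block_map n)) <-> forall n, last_injective (@phi n).
Proof.
split=> inj n u v.
  move=> uv fuv; suff -> : u = v by [].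
  apply: (inj n.+1); apply/initialP => i; rewrite ltnS leq_eqVlt /causal_map.
  case/predU1P => [->|ltin]; first by rewrite !initial_extend.
  congr phi; apply/initialP => j leji.
  have ltjn : (j < n)%N by exact: leq_trans leji ltin.
  by rewrite /extend (insubT (fun k => k < n.+1)%N (leqW ltjn)) /=;
    move: (uv (Ordinal ltjn)); congr (_ = _); congr fun_of_fin; exact: val_inj.
rewrite -[u]initial_extend -[v]initial_extend.
move: (extend u) (extend v) => {u v} x y.
rewrite -!initial_causal_map => /initialP fxy; apply/initialP => i.
elim/ltn_ind: i => i IH ltin.
have /inj := fxy i ltin; rewrite !ffunE; apply=> k; rewrite !ffunE.
by apply: IH; rewrite ?(ltn_trans _ ltin) //=.
Qed.
End causal_maps.

(** * Laws of sequences of signs *)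

Section laws_of_sign_sequences.
Local Open Scope classical_set_scope.
Local Open Scope ring_scope.
Context d (T : measurableType d) (R : realType) (P : probability T R).
Implicit Types X Y : nat -> {RV P >-> pm1}.

Definition cylinder n (v : {ffun 'I_n -> pm1}) : set (seq_space pm1) :=
  [set x | initial n x = v].

(** The empty set is added to make the family stable under intersection: two
    cylinders are either nested or disjoint. *)
Definition cylinders : set (set (seq_space pm1)) :=
  [set C | C = set0 \/ exists n (v : {ffun 'I_n -> pm1}), C = cylinder v].

Lemma measurable_cylinder n (v : {ffun 'I_n -> pm1}) : measurable (cylinder v).
Proof.
have -> : cylinder v =
    \bigcap_(i in [set: 'I_n]) ((fun x : seq_space pm1 => x i) @^-1` [set v i]).
  apply/seteqP; split => [x <- i _|x xv]; first by rewrite /= ffunE.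
  by apply/ffunP => i; rewrite ffunE; exact: xv.
apply: fin_bigcap_measurable => [|i _]; first exact: finite_finset.
apply: sub_sigma_algebra; exists (i : nat) => //.
by exists [set v i] => //; rewrite setTI.
Qed.

Lemma setI_closed_cylinders : setI_closed cylinders.
Proof.
move=> A B [->|[n [v ->]]] [->|[m [w ->]]];
  rewrite ?set0I ?setI0; try by left.
wlog lenm : n m v w / (n <= m)%N.
  move=> th; case: (leqP n m) => [|/ltnW] le; first exact: th.
  by rewrite setIC; exact: th.
have [[x [xv xw]]|] := pselect (cylinder v `&` cylinder w !=set0); last first.
  by move/set0P/negP/negPn/eqP => ->; left.
right; exists m, w; rewrite setIidr // => y yw; rewrite /cylinder /= -xv.
apply/initialP => i ltin; have /initialP := etrans yw (esym xw).
by apply; exact: leq_trans ltin lenm.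
Qed.

(** Signs being finite in number, an event on coordinate [n] is the finite union
    of the cylinders of length [n.+1] whose last entry satisfies it. *)
Lemma measurable_cylinders :
  @measurable _ (seq_space pm1) = <<s cylinders >>.
Proof.
apply/seteqP; split; apply: smallest_sub; try exact: smallest_sigma_algebra.
- move=> _ [n _ [A _ <-]]; rewrite setTI.
  have -> : (fun x : nat -> pm1 => x n) @^-1` A =
      \bigcup_(v in [set v : {ffun 'I_n.+1 -> pm1} | A (v ord_max)]) cylinder v.
    apply/seteqP; split => [x Ax|x [v Av xv]]; last by move: Av; rewrite -xv /= ffunE.
    by exists (initial n.+1 x) => //=; rewrite ffunE.
  apply: (@fin_bigcup_measurable _ (g_sigma_algebraType cylinders)).
    exact: finite_finset.
  by move=> v _; apply: sub_sigma_algebra; right; exists n.+1, v.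
- move=> _ [->|[n [v ->]]]; [exact: measurable0|exact: measurable_cylinder].
Qed.

(** Two probability measures that agree on a pi-system agree on the sigma-algebra
    that it generates. *)
Lemma same_law_cylinderP X Y :
  same_law (seq_RV X) (seq_RV Y) <->
  forall n (v : {ffun 'I_n -> pm1}),
    P [set t | initial n (X^~ t) = v]%classic =
    P [set t | initial n (Y^~ t) = v]%classic.
Proof.
split=> [XY n v|XY A mA]; first exact: (XY _ (measurable_cylinder v)).
apply: (measure_unique cylinders (fun=> setT) measurable_cylinders
  setI_closed_cylinders) => //.
- move=> _; right; exists 0%N, [ffun=> point]; apply/seteqP; split => // x _.
  by apply/ffunP => - [].
- by rewrite bigcup_const.
- by move=> _ [->|[n [v ->]]]; [rewrite !measure0|exact: XY].
- by move=> _; apply: (le_lt_trans _ (ltry 1)); exact: probability_le1.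
Qed.

Lemma fair_coin_cylinder X : iid X ->
  P [set t | pm1_val (X 0%N t) = -1]%classic = (2^-1)%:E ->
  P [set t | pm1_val (X 0%N t) = 1]%classic = (2^-1)%:E ->
  forall n (v : {ffun 'I_n -> pm1}),
    P [set t | initial n (X^~ t) = v]%classic = (2^-1 ^+ n)%:E.
Proof.
move=> [indep same] Xneg Xpos n v.
have half i s : P (X i @^-1` [set s]) = (2^-1)%:E.
  transitivity (P (X 0%N @^-1` [set s])); first exact: (same i [set s] I).
  have -> : X 0%N @^-1` [set s] = [set t | pm1_val (X 0%N t) = pm1_val s]%classic.
    by apply/seteqP; split => t /= => [->|] //; exact: val_inj.
  by case: (pm1P s) => ->.
pose J := fset_set `I_n.
have JE : [set` J] = `I_n by rewrite fset_setK //; exact: finite_II.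
have := indep J (fun i => [set extend v i]) (fun=> I).
rewrite JE => PJ; transitivity (P (\bigcap_(i in `I_n) (X i @^-1` [set extend v i]))).
  congr (P _); rewrite -{1}[v]initial_extend.
  by apply/seteqP; split => t /initialP.
rewrite PJ (eq_bigr _ (fun i _ => half i _)) prodEFin big_const_seq count_predT iter_mulr_1.
by rewrite (card_fset_set (card_eqxx _)).
Qed.

(** If the laws agree, every word of length [n] has positive probability for the
    transformed sequence, so the block map is onto, hence injective by
    finiteness.  If the block map is bijective, the event that the transformed
    segment is [v] is the event that the original one is the preimage of [v],
    and all words have the same probability. *)
Lemma same_law_eta_injP (xi : nat -> {RV P >-> pm1})
    (phi : forall n, {ffun 'I_n.+1 -> pm1} -> pm1) :
  (forall n (v : {ffun 'I_n -> pm1}),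
    P [set t | initial n (xi^~ t) = v]%classic = (2^-1 ^+ n)%:E) ->
  same_law (seq_RV (eta_RV phi xi)) (seq_RV xi) <->
  forall n, injective (@block_map _ phi n).
Proof.
move=> unif; rewrite same_law_cylinderP.
have etaE n t : initial n ((eta_RV phi xi)^~ t) = block_map phi (initial n (xi^~ t)).
  exact: initial_causal_map.
split=> [law n|inj n v].
  have surj v : exists u, block_map phi u = v :> {ffun 'I_n -> pm1}.
    have : P [set t | initial n ((eta_RV phi xi)^~ t) = v]%classic != 0%E.
      by rewrite law unif eqe expf_neq0 // invr_neq0.
    have [[t <-] _|/set0P/negP/negPn/eqP ->] :=
        pselect ([set t | initial n ((eta_RV phi xi)^~ t) = v]%classic !=set0).
      by exists (initial n (xi^~ t)); rewrite etaE.
    by rewrite measure0 eqxx.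
  have [g gK] := choice surj.
  exact: can_inj (canF_sym gK).
have [g gK Kg] := injF_bij (inj n).
rewrite unif -(unif n (g v)); congr (P _).
by apply/seteqP; split => t /=; rewrite etaE; [move=> <-|move=> ->].
Qed.
End laws_of_sign_sequences.

Theorem theorem4 (R : realType) (d : measure_display) (T : measurableType d)
    (P : probability T R) (xi : nat -> {RV P >-> pm1})
    (xi_iid : iid xi)
    (xi_neg : P [set t | pm1_val (xi 0%N t) = -1]%classic = (2^-1)%:E)
    (xi_pos : P [set t | pm1_val (xi 0%N t) = 1]%classic = (2^-1)%:E)
    (phi : forall n : nat, {ffun 'I_n.+1 -> pm1} -> pm1) :
  (same_law (seq_RV (eta_RV phi xi)) (seq_RV xi)
   <->
   forall n : nat, exists beta : {set 'I_n} -> bool,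
     forall u : {ffun 'I_n.+1 -> pm1},
       (phi n u : rat) =
       (\prod_(K : {set 'I_n}) umax u K ^+ beta K) * u ord_max)
  /\
  (forall (n : nat) (beta : {set 'I_n} -> bool),
     (forall u : {ffun 'I_n.+1 -> pm1},
       (phi n u : rat) =
       (\prod_(K : {set 'I_n}) umax u K ^+ beta K) * u ord_max) ->
     let B : {set {set 'I_n}} := [set K | beta K]%SET in
     forall u : {ffun 'I_n.+1 -> pm1},
       (phi n u : rat) =
       (2^-1 * (-1) ^+ #|B|
        - 2^-1 * \sum_(H in finset.powerset B) (-2) ^+ #|H| * umax u (finset.cover H))
       * u ord_max).
Proof.
split=> [|n beta phiE B u].
  rewrite (same_law_eta_injP _ (fair_coin_cylinder xi_iid xi_neg xi_pos)).
  rewrite block_map_injP.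
  by split=> h n; apply/last_injectiveP; exact: h.
rewrite phiE -umax_expansion [in RHS]big_mkcond; congr (_ * _).
by apply: eq_bigr => K _; rewrite inE; case: (beta K).
Qed.
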